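(* Let $z\in Z$ and set $\ell=\mathbb{Q}(\sqrt{z})$. (i) If $z>0$, then $\tilde{P}(\ell):=\{(r,s,\tfrac{1}{2})\mid r\in\mathbb{Q},\ r<\tfrac{1}{2},\ s\in S(\ell),\ s<0\}\subset C_\ell$ is an irredundant subset of $P(\ell)$. (ii) If $z<0$, then $\tilde{P}(\ell):=\{(r,s,s-1)\mid r\in\mathbb{Q},\ r>\tfrac{1}{2},\ s\in S(\ell),\ s<0\}\subset C_\ell$ is an irredundant subset of $P(\ell)$.
   Context: $Z$ denotes the set of all square-free integers (positive or negative, non-zero) except $1$; thus $-1\in Z$. For $\ell=\mathbb{Q}(\sqrt z)$ with $z\in Z$: - if $z=-1$, $S(\ell)=\{w\in Z\mid w<0\}\setminus\{-1\}$; if $z\ne-1$, $S(\ell)=\{w\in Z: |\gcd(z,w)|<\sqrt{|z|}\}$; - if $z>0$, $P(\ell)=\{(c_1,c_2,c_3)\in\mathbb{Q}^3\mid c_1<\tfrac12,\ c_2<0,\ c_2<c_3<-c_2\}$; if $z<0$, $P(\ell)=\{(c_1,c_2,c_3)\in\mathbb{Q}^3\mid c_1>\tfrac12,\ c_3<0,\ c_3<c_2<-c_3\}$. For $x\in\ell$, $\overline{x}$ denotes the Galois conjugate of $x$ over $\mathbb{Q}$. For $c=(c_1,c_2,c_3)\in\mathbb{Q}^3$ and $x,y\in\ell$ let $$M_{c}(x,y)=\begin{pmatrix}x & c_2y+c_3\overline{y}\\ y & (1-c_1)x+c_1\overline{x}\end{pmatrix}\in \ell^{2\times 2}.$$ $A(\ell,c)$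 is the (not necessarily associative) four-dimensional $\mathbb{Q}$-algebra with underlying $\mathbb{Q}$-vector space $\ell^2$ and multiplication $$\begin{pmatrix}x\\ y\end{pmatrix}\begin{pmatrix}z'\\ w'\end{pmatrix}=M_{c}(x,y)\begin{pmatrix}z'\\ w'\end{pmatrix}\qquad(x,y,z',w'\in\ell),$$ the right-hand side being the ordinary matrix product over $\ell$. A $\mathbb{Q}$-algebra $A\neq\{0\}$ is a division algebra if for every $a\in A\setminus\{0\}$ the linear maps $x\mapsto ax$ and $x\mapsto xa$ are bijective. The set of admissible triples is $C_\ell=\{c\in\mathbb{Q}^3\mid A(\ell,c)\text{ is a division algebra}\}$; equivalently, $c\in C_\ell$ if and only if $\det M_c(x,y)\neq0$ for all $(x,y)\in\ell^2\setminus\{(0,0)\}$. A set of triples $P\subset C_\ell$ is irredundant if for any two distinct $c,d\in P$ the algebras $A(\ell,c)$ and $A(\ell,d)$ are not isomorphic as $\mathbb{Q}$-algebras. Known isomorphism criterion (from earlier work, may be used): for $c,d\in C_\ell$, $A(\ell,c)\cong A(\ell,d)$ if and only if there exists $x\in\ell^*=\ell\setminus\{0\}$ with $(c_1,c_2,c_3)=(d_1,x^2d_2,x\overline{x}\,d_3)$. *)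

(* Defs.v *)
From HB Require Import structures.
From mathcomp Require Import all_boot all_order all_algebra all_fingroup all_field.
From mathcomp Require Import sesquilinear classical_sets ring.

Set Implicit Arguments.
Unset Strict Implicit.
Unset Printing Implicit Defensive.

Import Order.TTheory GRing.Theory Num.Theory.
Local Open Scope ring_scope.
Local Open Scope classical_set_scope.

(** * Square-free integers, and the sets S(l) and P(l) for l = Q(sqrt z) *)

Definition squarefreez (n : int) : Prop :=
  n != 0 /\ forall d : int, (d ^+ 2 %| n)%Z -> `|d| = 1.

Definition Zsqf : set int := [set n | squarefreez n /\ n != 1].

(* The square root of the nonnegative |z| is taken in [algC]. *)
Definition Sset (z : int) : set int :=
  if z == -1 then [set w | Zsqf w /\ w < 0] `\ (-1)
  else [set w | Zsqf w /\ `|gcdz z w|%:~R < sqrtC `|z|%:~R :> algC].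

(* For z <> 0; the second branch is the case z < 0. *)
Definition Pset (z : int) : set (rat * rat * rat) :=
  if 0 < z
  then [set c | let: (c1, c2, c3) := c in
                [/\ c1 < 2^-1, c2 < 0 & c2 < c3 < - c2]]
  else [set c | let: (c1, c2, c3) := c in
                [/\ c1 > 2^-1, c3 < 0 & c3 < c2 < - c3]].

(** * Quadratic fields *)

Lemma Zsqf_not_square (z : int) (q : rat) : Zsqf z -> q ^+ 2 != z%:~R.
Proof.
move=> [[z0 sq] z1]; apply/negP => /eqP qz.
have E : numq q ^+ 2 = z * denq q ^+ 2.
  apply/eqP; rewrite -(eqr_int rat) intrM !rmorphXn /= -qz -exprMn.
  by rewrite -numqE.
have d1 : denq q = 1.
  have : coprimez (denq q) (numq q ^+ 2).
    by rewrite coprimezXr // coprimez_sym coprimezE coprime_num_den.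
  rewrite E coprimezMr => /andP[_]; rewrite coprimez_pexpr // /coprimez gcdzz.
  by have := denq_gt0 q; case: (denq q) => // n _ /eqP [->].
have : (numq q ^+ 2 %| z)%Z by rewrite E d1 expr1n mulr1.
move/sq => n1; move: E; rewrite d1 expr1n mulr1 -real_normK ?num_real // n1 expr1n => /esym Ez.
by rewrite Ez in z1.
Qed.

(* The hypotheses describing a pair (Q(sqrt z), conjugation) by a generator and
   a nontrivial Galois automorphism are satisfiable for every z in Z. *)
Lemma quadratic_field_exists (z : int) : Zsqf z ->
  exists (L : splittingFieldType rat) (w : L) (conj : gal_of {:L}),
  [/\ w ^+ 2 = z%:~R, <<1; w>>%VS = fullv & conj \in ('Gal({:L} / 1)^#)%g].
Proof.
move=> zZ.
have [L0 [LC [[|w []] // [Dw] gen]]] := num_field_exists [:: sqrtC z%:~R].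
have wz : w ^+ 2 = z%:~R.
  by apply: (fmorph_inj LC); rewrite rmorphXn rmorph_int /= Dw sqrtCK.
have w0 : w != 0.
  case: zZ => [[z0 _] _].
  by rewrite -sqrf_eq0 wz -(fmorph_eq0 LC) rmorph_int intr_eq0.
pose p : {poly L0} := 'X^2 - (z%:~R)%:P.
have pE : p = \prod_(y <- [:: w; - w]) ('X - y%:P).
  rewrite /p big_cons big_seq1 polyCN opprK -wz rmorphXn /=; ring.
have p1 : p \is a polyOver 1%VS.
  by rewrite rpredB ?polyOverX ?rpredX ?polyOverC ?polyOverX // rpred_int.
have spl : splittingFieldFor 1 p {:L0}.
  exists [:: w; - w]; first by rewrite pE eqpxx.
  apply/eqP; rewrite eqEsubv subvf -gen adjoin_seqSr //= => x.
  by rewrite !inE => ->.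
have ax : FieldExt_isSplittingField _ L0 by constructor; exists p.
pose L := HB.pack_for (splittingFieldType rat) L0 ax.
have gal : galois 1 {:L}.
  apply/(@splitting_galoisField _ L); exists p; split => //.
  rewrite /= pE separable_prod_XsubC /= inE andbT.
  apply/eqP => ww; have /eqP : w *+ 2 = 0 by rewrite mulr2n {2}ww subrr.
  by rewrite -mulr_natr mulf_eq0 (negPf w0) /= -(fmorph_eq0 LC) rmorph_nat pnatr_eq0.
exists L, w.
have gen1 : <<1; w>>%VS = fullv by rewrite -gen span_seq1.
case: (pickP [pred g in ('Gal({:L} / 1)^#)%g]) => [g Hg|H]; first by exists g.
have G1 : ('Gal({:L} / 1) = 1)%g.
  apply/trivgP/fintype.subsetP => g gG.
  by have := H g; rewrite /= !inE gG andbT => /negbFE.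
have : (w : L) \in (1%VS : {vspace L}).
  rewrite -[1%VS](galois_fixedField gal) G1; apply/fixedFieldP; first exact: memvf.
  by move=> x /set1P ->; rewrite gal_id.
case/vlineP => k Dk; have := Zsqf_not_square k zZ.
by rewrite -(inj_eq (fmorph_inj (in_alg L))) rmorphXn rmorph_int /= -Dk wz eqxx.
Qed.

(** * Not necessarily associative algebras over a field *)

Record na_algebra (K : fieldType) := NaAlgebra {
  na_sort :> vectType K;
  na_mul : {bilinear na_sort -> na_sort -> na_sort}
}.

Definition division_algebra (K : fieldType) (A : na_algebra K) : Prop :=
  (exists a : A, a != 0) /\
  forall a : A, a != 0 ->
    bijective (fun x => na_mul A a x) /\ bijective (fun x => na_mul A x a).

Definition isomorphic (K : fieldType) (A B : na_algebra K) : Prop :=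
  exists f : {linear A -> B},
    bijective f /\ forall a b, f (na_mul A a b) = na_mul B (f a) (f b).

(** * The algebras A(l, c) *)

Section Algebra.
Variables (L : splittingFieldType rat) (conj : gal_of {:L}).
Implicit Types (c : rat * rat * rat) (x y : L) (a b : L * L).

Definition Mmx c x y : 'M[L]_2 :=
  let: (c1, c2, c3) := c in
  \matrix_(i < 2, j < 2)
    if i == 0 then (if j == 0 then x else c2 *: y + c3 *: conj y)
    else (if j == 0 then y else (1 - c1) *: x + c1 *: conj x).

(* L^2 is represented by the product L * L, which carries the structure of a
   rational vector space (column vectors over L only have an L-structure). *)
Definition colpair a : 'cV[L]_2 := \col_(i < 2) if i == 0 then a.1 else a.2.

Definition mulA c a b : L * L :=
  let v := Mmx c a.1 a.2 *m colpair b in (v 0 0, v 1 0).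

Lemma mulAE c a b : mulA c a b =
  (a.1 * b.1 + (c.1.2 *: a.2 + c.2 *: conj a.2) * b.2,
   a.2 * b.1 + ((1 - c.1.1) *: a.1 + c.1.1 *: conj a.1) * b.2).
Proof.
by case: c => [[c1 c2] c3]; rewrite /mulA /= !mxE !big_ord_recl !big_ord0 !mxE /=
  !addr0.
Qed.

Lemma mulA_bilinear c : bilinear_for *:%R *:%R (mulA c).
Proof.
have scE (k : rat) (x : L) : k *: x = in_alg L k * x by rewrite mulr_algl.
split=> [[e f] | [e f]] q [u v] [g h]; rewrite !mulAE /=; congr (_, _);
  rewrite ?linearP /= !scE; ring.
Qed.

HB.instance Definition _ c :=
  bilinear_isBilinear.Build rat (L * L)%type (L * L)%type (L * L)%type
    *:%R *:%R (mulA c) (mulA_bilinear c).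

Definition Aalg c : na_algebra rat :=
  @NaAlgebra rat (L * L)%type (mulA c).

Definition Cset : set (rat * rat * rat) := [set c | division_algebra (Aalg c)].

Definition irredundant (P : set (rat * rat * rat)) : Prop :=
  forall c d, P c -> P d -> c <> d -> ~ isomorphic (Aalg c) (Aalg d).

End Algebra.

(* Main.v *)
From HB Require Import structures.
Require Import Defs.
From mathcomp Require Import all_boot all_order all_algebra all_fingroup.
From mathcomp Require Import all_field classical_sets ring lra.

(** Write w for the square root of z and split every element of L as a + b w
    with a and b rational.

    Division property.  In these coordinates the rational part of
    det M_c(x, y), for x = a + b w and y = e + f w, is the diagonal form
      a^2 + (1 - 2 c1) z b^2 - (c2 + c3) e^2 - (c2 - c3) z f^2,
    and the inequalities defining P(l) say exactly that its coefficients are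
    positive.  So the determinant vanishes only at 0, whence A(l, c) has no zero
    divisors and, being finite dimensional, is a division algebra
    ([definite_division]).  It remains to see that the families lie in P(l),
    which holds because a negative integer is at most -1.

    Irredundancy.  When c2 and c3 are nonzero, the right nucleus of A(l, c), the
    set of n with (a b) n = a (b n) for all a and b, is the subfield l x 0
    ([right_nucleus_sub_field]).  An isomorphism F preserves right nuclei, so it
    induces an embedding of l into itself; comparing the products of w with
    j = (0, 1), of j with itself and of j w with j then gives q in l with
    c1 = d1, c2 = q^2 d2 and c3 = q (conj q) d3 ([isomorphic_parameters]).  For
    q = a + b w the middle equation forces a b = 0, as c2 and d2 are rational.
    If a = 0, then q^2 = z b^2 while q (conj q) = - z b^2: for z > 0 the latter
    is not the ratio 1 of the third parameters, and for z < 0 the former is not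
    the ratio of the two negative numbers c2 and d2.  If b = 0, then q^2 and
    q (conj q) are both a^2, and a^2 = 1: the third parameters are equal for
    z > 0, and for z < 0 each exceeds the second one by the constant -1.  So
    c = d. *)

Set Implicit Arguments.
Unset Strict Implicit.
Unset Printing Implicit Defensive.

Import Order.TTheory GRing.Theory Num.Theory.
Local Open Scope ring_scope.
Local Open Scope classical_set_scope.

(** * Division algebras of finite dimension *)

Lemma injective_endomorphism_bijective (K : fieldType) (V : vectType K)
    (g : V -> V) : linear g -> injective g -> bijective g.
Proof.
move=> g_lin g_inj.
pose gL := HB.pack_for {linear V -> V} g (GRing.isLinear.Build _ _ _ _ g g_lin).
have gE : linfun gL =1 g by move=> v; rewrite lfunE.
have ker0 : lker (linfun gL) == 0%VS.
  by apply/lker0P => u v; rewrite !gE; apply: g_inj.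
exists (linfun gL)^-1%VF => v.
  by rewrite -gE lker0_lfunK.
by rewrite -gE lker0_lfunVK.
Qed.

Lemma division_algebra_no_zero_divisors (K : fieldType) (A : na_algebra K) :
    (exists a : A, a != 0) ->
    (forall a b : A, na_mul A a b = 0 -> a = 0 \/ b = 0) ->
  division_algebra A.
Proof.
move=> A_neq0 nzd; split=> // a /eqP a0.
split; apply: injective_endomorphism_bijective.
- by move=> k u v; rewrite linearPr.
- move=> u v /eqP; rewrite -subr_eq0 -linearBr => /eqP /nzd [//|/eqP].
  by rewrite subr_eq0 => /eqP.
- by move=> k u v; rewrite linearPl.
- move=> u v /eqP; rewrite -subr_eq0 -linearBl => /eqP /nzd [/eqP|//].
  by rewrite subr_eq0 => /eqP.
Qed.

(** * Coordinates in a quadratic field *)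

Section QuadraticField.

(* [iota] is the map [in_alg L], kept abstract: the concrete one unfolds under
   simplification, which hides the ring morphism. *)
Variables (L : splittingFieldType rat) (iota : {rmorphism rat -> L}).
Hypothesis scaleE : forall (k : rat) (x : L), k *: x = iota k * x.
Variables (z : rat) (w : L).
Hypotheses (wE : w ^+ 2 = iota z) (gen_w : <<1; w>>%VS = fullv).

Lemma quadratic_coordinates (x : L) :
  exists a b : rat, x = iota a + iota b * w.
Proof.
have : x \in <<1; w>>%VS by rewrite gen_w memvf.
case/Fadjoin_polyP => p; move: x; elim/poly_ind: p => [|p k IH] x p1 ->.
  by exists 0, 0; rewrite horner0 !rmorph0 mul0r addr0.
have k1 : k \in (1%VS : {vspace L}).
  by move/polyOverP: p1 => /(_ 0%N); rewrite coefD coefMX coefC add0r.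
have p1' : p \is a polyOver (1%VS : {vspace L}).
  apply/polyOverP => i; move/polyOverP: p1 => /(_ i.+1).
  by rewrite coefD coefMX coefC addr0.
case/vlineP: k1 => h ->; have [a [b E]] := IH _ p1' erefl.
exists (b * z + h), a; rewrite hornerMXaddC E scaleE mulr1 rmorphD rmorphM -wE.
ring.
Qed.

Variable conj : gal_of {:L}.
Hypotheses (conj_neq1 : conj != 1%g) (z_neq0 : z != 0).

Lemma conj_rat k : conj (iota k) = iota k.
Proof. by rewrite -[iota k]mulr1 -scaleE linearZ /= rmorph1. Qed.

Lemma w_neq0 : w != 0.
Proof. by rewrite -sqrf_eq0 wE fmorph_eq0. Qed.

Lemma conj_w : conj w = - w.
Proof.
have : conj w ^+ 2 == w ^+ 2 by rewrite -rmorphXn /= wE conj_rat.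
rewrite eqf_sqr => /orP[/eqP conjw|/eqP //].
case/negP: conj_neq1; apply/gal_eqP => x _; rewrite gal_id.
have [a [b ->]] := quadratic_coordinates x.
by rewrite rmorphD rmorphM /= !conj_rat conjw.
Qed.

Lemma conj_sqrt (t : L) : t ^+ 2 = iota z -> conj t = - t.
Proof.
move=> /eqP; rewrite -wE eqf_sqr => /orP[] /eqP ->; first exact: conj_w.
by rewrite rmorphN /= conj_w.
Qed.

Lemma conj_coordinates a b :
  conj (iota a + iota b * w) = iota a - iota b * w.
Proof. by rewrite rmorphD rmorphM /= !conj_rat conj_w mulrN. Qed.

Lemma coordinates_eq0 a b : iota a + iota b * w = 0 -> a = 0 /\ b = 0.
Proof.
move=> E; have := congr1 conj E; rewrite conj_coordinates rmorph0 => E'.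
have a0 : a = 0.
  apply: (fmorph_inj iota); rewrite rmorph0.
  apply: (@mulfI _ (iota 2)); first by rewrite fmorph_eq0.
  by rewrite mulr0 -[RHS]addr0 -{1}E -E' rmorph_nat; ring.
split=> //; move/eqP: E; rewrite a0 rmorph0 add0r mulf_eq0 (negPf w_neq0) orbF.
by rewrite fmorph_eq0 => /eqP.
Qed.

Lemma coordinates_inj a b a' b' :
    iota a + iota b * w = iota a' + iota b' * w ->
  a = a' /\ b = b'.
Proof.
move=> E; have [|/eqP] := @coordinates_eq0 (a - a') (b - b').
  rewrite !rmorphB /=; move/eqP: E; rewrite -subr_eq0 => /eqP E.
  rewrite -[RHS]E; ring.
by rewrite subr_eq0 => /eqP -> /eqP; rewrite subr_eq0 => /eqP ->.
Qed.

(** * Zero divisors *)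

(** The two entries of the second column of M_c(x, y) are [psi c y] and
    [phi c x]. *)
Definition phi (c : rat * rat * rat) (x : L) : L :=
  iota (1 - c.1.1) * x + iota c.1.1 * conj x.
Definition psi (c : rat * rat * rat) (y : L) : L :=
  iota c.1.2 * y + iota c.2 * conj y.

Lemma mulA_phi_psi c a b : Defs.mulA conj c a b =
  (a.1 * b.1 + psi c a.2 * b.2, a.2 * b.1 + phi c a.1 * b.2).
Proof. by rewrite mulAE /phi /psi !scaleE. Qed.

Lemma phi1 c : phi c 1 = 1.
Proof. by rewrite /phi rmorph1 !mulr1 -rmorphD subrK rmorph1. Qed.

Lemma phi_sqrt c (t : L) : t ^+ 2 = iota z ->
  phi c t = iota (1 - 2 * c.1.1) * t.
Proof. by move=> /conj_sqrt; rewrite /phi => ->; ring. Qed.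

Lemma phi0 c : phi c 0 = 0.
Proof. by rewrite /phi rmorph0 !mulr0 addr0. Qed.

Lemma psi0 c : psi c 0 = 0.
Proof. by rewrite /psi rmorph0 !mulr0 addr0. Qed.

Lemma psi1 c : psi c 1 = iota (c.1.2 + c.2).
Proof. by rewrite /psi rmorph1 !mulr1 rmorphD. Qed.

(** By Cramer's rule: the equation a b = 0 is the linear system with matrix
    M_c(a) in the unknown b, and multiplying by the adjugate gives
    det M_c(a) b = 0. *)
Lemma det_neq0_division c :
    (forall x y, x * phi c x - y * psi c y = 0 -> x = 0 /\ y = 0) ->
  Cset conj c.
Proof.
move=> det_neq0; apply: division_algebra_no_zero_divisors.
  exists (1, 0) => /=; apply/eqP => -[/eqP]; by rewrite oner_eq0.
move=> [x y] [u v] /=; rewrite mulA_phi_psi /= => -[E1 E2].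
have [D0|Dn0] := eqVneq (x * phi c x - y * psi c y) 0.
  by left; have [-> ->] := det_neq0 _ _ D0.
right; congr (_, _); apply: (mulfI Dn0); rewrite mulr0.
  transitivity (phi c x * (x * u + psi c y * v)
                - psi c y * (y * u + phi c x * v)); first ring.
  by rewrite E1 E2 !mulr0 subr0.
transitivity (x * (y * u + phi c x * v) - y * (x * u + psi c y * v)); first ring.
by rewrite E1 E2 !mulr0 subr0.
Qed.

(** The three inequalities make the rational part of the determinant a positive
    definite diagonal form in the four coordinates of (x, y). *)
Lemma definite_division (c : rat * rat * rat) :
    0 < (1 - 2 * c.1.1) * z -> c.1.2 + c.2 < 0 -> (c.1.2 - c.2) * z < 0 ->
  Cset conj c.
Proof.
move=> pos1 neg1 neg2; apply: det_neq0_division => x y.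
have [a [b ->]] := quadratic_coordinates x.
have [e [f ->]] := quadratic_coordinates y.
(* The determinant is [N + T w]. *)
pose N := a ^+ 2 + (1 - 2 * c.1.1) * z * b ^+ 2
  - (c.1.2 + c.2) * e ^+ 2 - (c.1.2 - c.2) * z * f ^+ 2.
pose T := 2 * ((1 - c.1.1) * a * b - c.1.2 * e * f).
move=> E; have {E} [N0 _] : N = 0 /\ T = 0.
  apply: coordinates_eq0; rewrite -[RHS]E /phi /psi !conj_coordinates /N /T.
  rewrite !(rmorphD, rmorphB, rmorphM, rmorphN, rmorphXn, rmorph1) /=.
  rewrite -wE; ring.
have a2 := sqr_ge0 a; have b2 := sqr_ge0 b.
have e2 := sqr_ge0 e; have f2 := sqr_ge0 f.
have Ha : 0 <= (1 - 2 * c.1.1) * z * b ^+ 2 by rewrite mulr_ge0 // ltW.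
have He : (c.1.2 + c.2) * e ^+ 2 <= 0 by rewrite mulr_le0_ge0 // ltW.
have Hf : (c.1.2 - c.2) * z * f ^+ 2 <= 0 by rewrite mulr_le0_ge0 // ltW.
have a0 : a ^+ 2 == 0 by apply/eqP; move: N0; rewrite /N; lra.
have b0 : (1 - 2 * c.1.1) * z * b ^+ 2 == 0.
  by apply/eqP; move: N0; rewrite /N; lra.
have e0 : (c.1.2 + c.2) * e ^+ 2 == 0 by apply/eqP; move: N0; rewrite /N; lra.
have f0 : (c.1.2 - c.2) * z * f ^+ 2 == 0.
  by apply/eqP; move: N0; rewrite /N; lra.
rewrite mulf_eq0 (gt_eqF pos1) in b0.
rewrite mulf_eq0 (lt_eqF neg1) in e0.
rewrite mulf_eq0 (lt_eqF neg2) in f0.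
move: a0 b0 e0 f0; rewrite /= !sqrf_eq0.
by do 4![move=> /eqP ->]; rewrite !rmorph0 mul0r addr0.
Qed.

(** * The right nucleus and isomorphisms *)

Definition right_nuclear c (n : L * L) : Prop := forall a b,
  Defs.mulA conj c (Defs.mulA conj c a b) n
    = Defs.mulA conj c a (Defs.mulA conj c b n).

(** Right multiplication by (u, 0) multiplies both components by u, and left
    multiplications are L-linear. *)
Lemma right_nuclear_field c u : right_nuclear c (u, 0).
Proof.
move=> [x y] [x' y']; rewrite !mulA_phi_psi /= !mulr0 !addr0.
by congr (_, _); ring.
Qed.

(** Let v be the second component of a right nuclear element.  If v is nonzero,
    associativity with a = b = (w, 0) makes phi multiplicative at w, so that phi
    is the identity (c1 = 0) or the conjugation (c1 = 1); associativity with
    a = (w, 0) and b = (0, 1) then makes psi linear (c3 = 0) or semilinear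
    (c2 = 0), respectively. *)
Lemma right_nucleus_sub_field (c : rat * rat * rat) n :
  c.1.2 != 0 -> c.2 != 0 -> right_nuclear c n -> n.2 = 0.
Proof.
case: n => u v c2 c3 nuc /=; apply/eqP; apply: contraT => v0.
have phiE := phi_sqrt c wE.
have /(congr1 snd) := nuc (w, 0) (w, 0).
rewrite !mulA_phi_psi /= !(psi0, mul0r, mulr0, add0r, addr0) -expr2.
rewrite wE mulrA => /(mulIf v0).
have -> : phi c (iota z) = iota z.
  by rewrite /phi conj_rat -!rmorphM -rmorphD; congr (iota _); ring.
rewrite phiE => E1.
have {E1} E1 : z = (1 - 2 * c.1.1) ^+ 2 * z.
  apply: (fmorph_inj iota); rewrite [LHS]E1.
  by rewrite rmorphM rmorphXn /= -wE; ring.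
have {}E1 : c.1.1 * (c.1.1 - 1) = 0.
  apply: (mulIf z_neq0); move: E1; rewrite mul0r; lra.
have /(congr1 fst) := nuc (w, 0) (0, 1).
rewrite !mulA_phi_psi /= !(psi0, phi0, mul0r, mulr0, mulr1, add0r, addr0).
rewrite phiE psi1 mulrA => /(mulIf v0).
rewrite /psi rmorphM /= conj_rat conj_w => E2.
have {E2} E2 : (1 - 2 * c.1.1) * (c.1.2 - c.2) = c.1.2 + c.2.
  apply: (fmorph_inj iota); apply: (mulIf w_neq0); rewrite [RHS]mulrC -E2.
  rewrite rmorphM rmorphB /=; ring.
move/eqP: E1; rewrite mulf_eq0 => /orP[] /eqP c1.
  by case/eqP: c3; move: E2; rewrite c1; lra.
have {}c1 : c.1.1 = 1 by lra.
by case/eqP: c2; move: E2; rewrite c1; lra.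
Qed.

(** The isomorphism f sends l x 0 to itself, through an embedding tau, as it
    preserves right nuclei.  If f(0, 1) = (p, q), then right multiplication by
    l x 0 gives f(x, y) = (tau x + p tau y, q tau y), so that q is nonzero.  The
    images of the products w j, j j and (j w) j, where j = (0, 1), determine
    c1, then p = 0, c2 + c3 and c2 - c3. *)
Lemma isomorphic_parameters (c d : rat * rat * rat) : d.1.2 != 0 -> d.2 != 0 ->
    isomorphic (Aalg conj c) (Aalg conj d) ->
  exists q : L, [/\ c.1.1 = d.1.1, iota c.1.2 = iota d.1.2 * q ^+ 2
    & iota c.2 = iota d.2 * (q * conj q)].
Proof.
move=> d2 d3 [F [[g gK fK]] FM].
have [f [fM fD fZ {}gK {}fK]] : exists f : L * L -> L * L,
    [/\ forall a b, f (Defs.mulA conj c a b) = Defs.mulA conj d (f a) (f b),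
        forall x y, f (x, y) = f (x, 0) + f (0, y),
        forall k x y, f (iota k * x, iota k * y)
          = (iota k * (f (x, y)).1, iota k * (f (x, y)).2),
        cancel f g & cancel g f].
  exists F; split=> // [x y|k x y].
    by rewrite -[RHS](raddfD F); congr (F (_, _)); rewrite /= ?addr0 ?add0r.
  by rewrite -!scaleE -[LHS]/(F (k *: ((x, y) : Aalg conj c))) linearZ.
have fZl k x : f (iota k * x, 0) = (iota k * (f (x, 0)).1, iota k * (f (x, 0)).2).
  by rewrite -fZ mulr0.
have fZr k x : f (0, iota k * x) = (iota k * (f (0, x)).1, iota k * (f (0, x)).2).
  by rewrite -fZ mulr0.
have f1 : f (1, 0) = (1, 0).
  have unit_r e a : Defs.mulA conj e a (1, 0) = a.
    by rewrite mulA_phi_psi /= !mulr0 !mulr1 !addr0; case: a.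
  have unit_l e a : Defs.mulA conj e (1, 0) a = a.
    by rewrite mulA_phi_psi /= phi1 psi0 !mul0r !mul1r addr0 add0r; case: a.
  have := fM (g (1, 0)) (1, 0).
  by rewrite unit_r fK unit_l => <-.
have f_nuclear n : right_nuclear c n -> right_nuclear d (f n).
  by move=> nuc a b; rewrite -[a]fK -[b]fK -!fM nuc.
pose tau x := (f (x, 0)).1.
have fl x : f (x, 0) = (tau x, 0).
  have := right_nucleus_sub_field d2 d3 (f_nuclear _ (right_nuclear_field c x)).
  by rewrite /tau; case: (f (x, 0)) => u v /= ->.
pose t := tau w.
have tE : t ^+ 2 = iota z.
  have := fM (w, 0) (w, 0); rewrite !fl !mulA_phi_psi /=.
  rewrite !(mulr0, mul0r, addr0) -!expr2 wE => /(congr1 fst) /= <-.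
  by rewrite -[iota z]mulr1 fZl f1 /= mulr1.
have t0 : t != 0 by rewrite -sqrf_eq0 tE fmorph_eq0.
pose p := (f (0, 1)).1; pose q := (f (0, 1)).2.
have fj : f (0, 1) = (p, q) by rewrite /p /q; case: (f _).
have fjx x : f (0, x) = (p * tau x, q * tau x).
  have := fM (0, 1) (x, 0); rewrite fl fj !mulA_phi_psi /=.
  by rewrite !(mulr0, mul0r, addr0, mul1r).
have q0 : q != 0.
  apply/eqP => q0; have : (f (g (0, 1))).2 = 1 by rewrite fK.
  case: (g (0, 1)) => x y.
  by rewrite fD fl fjx /= q0 mul0r addr0 => /esym/eqP; rewrite oner_eq0.
have phi_t : phi d t = iota (1 - 2 * d.1.1) * t := phi_sqrt d tE.
have Ew : f (0, iota (1 - 2 * c.1.1) * w) =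
    (iota (1 - 2 * c.1.1) * (p * t), iota (1 - 2 * c.1.1) * (q * t)).
  by rewrite fZr fjx.
have := fM (w, 0) (0, 1); rewrite fl fj !mulA_phi_psi /=.
rewrite !(psi0, mulr0, mul0r, add0r, addr0, mulr1) (phi_sqrt c wE) Ew phi_t.
case=> Ep Eq.
have c1d1 : c.1.1 = d.1.1.
  have /(fmorph_inj iota) : iota (1 - 2 * c.1.1) = iota (1 - 2 * d.1.1).
    apply: (mulIf (mulf_neq0 q0 t0)); rewrite Eq; ring.
  by lra.
have f_iota k : f (iota k, 0) = (iota k, 0).
  by rewrite -[iota k]mulr1 fZl f1 /= mulr0 mulr1.
have := fM (0, 1) (0, 1); rewrite fj !mulA_phi_psi /=.
rewrite !(psi0, phi0, mulr0, mul0r, add0r, addr0, mulr1) psi1 f_iota.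
case=> Esum Eqp.
(* The second component of f(w j) gives c1 p = 0, and that of f(j j) gives
   2 p q = 0 in the remaining case c1 = 0, where phi is the identity. *)
have p0 : p = 0.
  have [c10|c1n0] := eqVneq c.1.1 0.
    move: Eqp; rewrite /phi -c1d1 c10 subr0 rmorph0 mul0r addr0 rmorph1 mul1r.
    move=> E; have /eqP : iota 2 * (q * p) = 0.
      by rewrite rmorph_nat [RHS]E; ring.
    by rewrite !mulf_eq0 fmorph_eq0 (negPf q0) => /eqP.
  have nz : iota (2 * c.1.1) * t != 0.
    by rewrite mulf_neq0 // fmorph_eq0 mulf_neq0.
  apply: (mulfI nz); rewrite mulr0.
  transitivity (t * p - iota (1 - 2 * c.1.1) * (p * t)); first ring.
  by rewrite -Ep subrr.
have Edif : iota (c.1.2 - c.2) = iota d.1.2 * q ^+ 2 - iota d.2 * (q * conj q).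
  have := fM (0, w) (0, 1); rewrite fj fjx p0 !mulA_phi_psi /=.
  rewrite !(psi0, phi0, mulr0, mul0r, add0r, addr0, mulr1).
  have -> : psi c w = iota (c.1.2 - c.2) * w by rewrite /psi conj_w; ring.
  rewrite fZl fl => -[]; rewrite /psi rmorphM /= (conj_sqrt tE) => E _.
  apply: (mulIf t0); rewrite E; ring.
move: Esum; rewrite p0 mul0r add0r /psi => Esum.
have half (k : rat) (x : L) : iota (2 * k) = iota 2 * x -> iota k = x.
  by rewrite rmorphM; apply: mulfI; rewrite fmorph_eq0.
exists q; split=> //; apply: half.
  transitivity (iota (c.1.2 + c.2) + iota (c.1.2 - c.2)); first ring.
  rewrite Esum Edif; ring.
transitivity (iota (c.1.2 + c.2) - iota (c.1.2 - c.2)); first ring.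
rewrite Esum Edif; ring.
Qed.

(** The coordinates of the scaling factor q = a + b w: since q^2 is the ratio of
    two rational numbers, its coordinate 2 a b along w vanishes. *)
Lemma isomorphic_parameters_rat (c d : rat * rat * rat) :
    d.1.2 != 0 -> d.2 != 0 -> isomorphic (Aalg conj c) (Aalg conj d) ->
  exists a b : rat, [/\ c.1.1 = d.1.1, a * b = 0,
    c.1.2 = d.1.2 * (a ^+ 2 + z * b ^+ 2) & c.2 = d.2 * (a ^+ 2 - z * b ^+ 2)].
Proof.
move=> d2 d3 /isomorphic_parameters [//|//|q [c1 E2 E3]].
have [a [b qE]] := quadratic_coordinates q; exists a, b.
have [{}E2 ab] : c.1.2 = d.1.2 * (a ^+ 2 + z * b ^+ 2) /\ 0 = d.1.2 * 2 * (a * b).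
  apply: coordinates_inj; rewrite rmorph0 mul0r addr0 E2 qE.
  rewrite !(rmorphD, rmorphM, rmorphXn) /= -wE; ring.
split=> //.
  by move/esym/eqP: ab; rewrite mulf_eq0 mulf_eq0 (negPf d2) => /eqP.
apply: (fmorph_inj iota); rewrite E3 qE conj_coordinates.
rewrite !(rmorphB, rmorphM) /= -wE; ring.
Qed.

End QuadraticField.

(** * The sets P(l) and the two families *)

Lemma Pset_definite (z : int) (c1 c2 c3 : rat) :
  z != 0 -> Pset z (c1, c2, c3) ->
  [/\ 0 < (1 - 2 * c1) * z%:~R, c2 + c3 < 0 & (c2 - c3) * z%:~R < 0].
Proof.
move=> z0; rewrite /Pset; case: ltP => [z_gt0|z_le0] [c1P c2P /andP[c3l c3r]].
  have zq : 0 < z%:~R :> rat by rewrite ltr0z.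
  by split; [apply: mulr_gt0 => //| |rewrite (pmulr_llt0 _ zq)]; lra.
have zq : z%:~R < 0 :> rat by rewrite ltrz0 lt_neqAle z0.
by split; [rewrite (nmulr_lgt0 _ zq)| |rewrite (nmulr_llt0 _ zq)]; lra.
Qed.

Lemma ltrz0_leN1 (s : int) : s < 0 -> s%:~R <= -1 :> rat.
Proof. by move=> s0; rewrite -[-1]/((-1)%:~R) ler_int -ltzD1. Qed.

Lemma Pset_real_family (z s : int) (r : rat) :
  0 < z -> r < 2^-1 -> s < 0 -> Pset z (r, s%:~R, 2^-1).
Proof.
by move=> z_gt0 r2 /ltrz0_leN1 s1; rewrite /Pset z_gt0; split=> //; lra.
Qed.

Lemma Pset_imaginary_family (z s : int) (r : rat) :
  z < 0 -> r > 2^-1 -> s < 0 -> Pset z (r, s%:~R, s%:~R - 1).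
Proof.
move=> z_lt0 r2 /ltrz0_leN1 s1; rewrite /Pset ltNge (ltW z_lt0).
by split=> //; lra.
Qed.

(** If q = b w, then q (conj q) = 1 reads - z b^2 = 1. *)
Lemma real_family_scaling (z s s' a b : rat) : 0 < z -> a * b = 0 ->
    s = s' * (a ^+ 2 + z * b ^+ 2) -> 2^-1 = 2^-1 * (a ^+ 2 - z * b ^+ 2) ->
  s = s'.
Proof.
move=> z_gt0 /eqP ab sE nrm.
have {}nrm : a ^+ 2 = 1 + z * b ^+ 2 by lra.
move: ab; rewrite mulf_eq0 => /orP[] /eqP x0.
  have : 0 <= z * b ^+ 2 by rewrite mulr_ge0 ?sqr_ge0 // ltW.
  by move: nrm; rewrite x0; lra.
by rewrite sE nrm x0; ring.
Qed.

(** If q = b w, then s = s' z b^2 is nonnegative. *)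
Lemma imaginary_family_scaling (z s s' a b : rat) : z < 0 -> s < 0 -> s' < 0 ->
    a * b = 0 -> s = s' * (a ^+ 2 + z * b ^+ 2) ->
    s - 1 = (s' - 1) * (a ^+ 2 - z * b ^+ 2) ->
  s = s'.
Proof.
move=> z_lt0 s_lt0 s'_lt0 /eqP ab sE nrm.
move: ab; rewrite mulf_eq0 => /orP[] /eqP x0.
  have : 0 <= s' * z * b ^+ 2 by rewrite mulr_ge0 ?sqr_ge0 // mulr_le0 // ltW.
  by move: sE; rewrite x0; lra.
have a2 : a ^+ 2 = 1 by move: sE nrm; rewrite x0; lra.
by rewrite sE x0 a2; ring.
Qed.

Theorem corollary2p5
    (z : int) (zZ : Zsqf z)
    (L : splittingFieldType rat) (sqrtz : L)
    (sqrtzE : sqrtz ^+ 2 = z%:~R) (genL : <<1; sqrtz>>%VS = fullv)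
    (conj : gal_of {:L}) (conj_gal : conj \in ('Gal({:L} / 1)^#)%g) :
  (0 < z ->
     let Pt : set (rat * rat * rat) :=
       [set c : rat * rat * rat | exists (r : rat) (s : int),
          [/\ r < 2^-1, Sset z s, s < 0 & c = (r, s%:~R, 2^-1)]] in
     [/\ Pt `<=` Cset conj, irredundant conj Pt & Pt `<=` Pset z])
  /\
  (z < 0 ->
     let Pt : set (rat * rat * rat) :=
       [set c : rat * rat * rat | exists (r : rat) (s : int),
          [/\ r > 2^-1, Sset z s, s < 0 & c = (r, s%:~R, s%:~R - 1)]] in
     [/\ Pt `<=` Cset conj, irredundant conj Pt & Pt `<=` Pset z]).
Proof.
have z0 : z != 0 by case: zZ => -[].
have conj1 : conj != 1%g by move: conj_gal; rewrite !inE => /andP[].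
have scaleE (k : rat) (x : L) : k *: x = in_alg L k * x by rewrite mulr_algl.
have zE : sqrtz ^+ 2 = in_alg L z%:~R by rewrite rmorph_int.
have zq0 : z%:~R != 0 :> rat by rewrite intr_eq0.
have P_C (P : set (rat * rat * rat)) : P `<=` Pset z -> P `<=` Cset conj.
  move=> sP [[c1 c2] c3] /sP /(Pset_definite z0) [pos1 neg1 neg2].
  exact: (definite_division scaleE zE genL conj1 zq0).
have iso := isomorphic_parameters_rat scaleE zE genL conj1 zq0.
have nz (s : int) : s < 0 -> s%:~R != 0 :> rat.
  by rewrite -(ltrz0 rat) => /lt_eqF ->.
split=> z_sgn Pt.
  have sP : Pt `<=` Pset z.
    by move=> _ [r [s [r2 _ s0 ->]]]; apply: Pset_real_family.
  split=> //; first exact: P_C.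
  move=> _ _ [r [s [_ _ s0 ->]]] [r' [s' [_ _ s0' ->]]] neq.
  case/iso => [||a [b [/= rr ab sE nrm]]]; [exact: nz|by []|apply: neq].
  have zq : 0 < z%:~R :> rat by rewrite ltr0z.
  by rewrite rr (real_family_scaling zq ab sE nrm).
have sP : Pt `<=` Pset z.
  by move=> _ [r [s [r2 _ s0 ->]]]; apply: Pset_imaginary_family.
split=> //; first exact: P_C.
move=> _ _ [r [s [_ _ s0 ->]]] [r' [s' [_ _ s0' ->]]] neq.
have sq : s%:~R < 0 :> rat by rewrite ltrz0.
have sq' : s'%:~R < 0 :> rat by rewrite ltrz0.
have zq : z%:~R < 0 :> rat by rewrite ltrz0.
case/iso => [||a [b [/= rr ab sE nrm]]]; first exact: nz.
  by rewrite lt_eqF // subr_lt0 (lt_trans sq').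
by apply: neq; rewrite rr (imaginary_family_scaling zq sq sq' ab sE nrm).
Qed.
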